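(* Let $\mathbf f$ be a $k$-ary function symbol of $\mathcal M$, $k\in\{0,1,2\}$, with $\mathbf f\notin\{\times,\div,\mathbf p\}$. Then there exists an existential first-order formula $\psi(x_0,\dots,x_{k-1},y,z)$ of $\mathcal M$ such that for all $d,t\in\omega$ with $d\ge t$ and all $a_0,\dots,a_{k-1},b\in\mathbf M_d$, we have $\mathbf f_{d,t}(a_0,\dots,a_{k-1})=b$ if and only if $\mathbf M_d\models\psi(a_0,\dots,a_{k-1},b,t)$.
   Context: $\mathcal M$ is the first-order language with equality with constant symbols $\mathbf 0,\mathbf 1,-\mathbf 1,\mathbf n$, unary function symbols $\mathcal N,\mathbf p$, and binary function symbols $+,\times,\div,\max,\min,\cap$. For $d\in\omega$ and $n=2^d$, $\mathbf M_d$ has universe $\{0,\dots,2^n-1\}$; $+,\times$ are modulo $2^n$; $\mathbf p(x)=\min\{2^x,2^n-1\}$; $\div(x,y)=\lfloor x/y\rfloor$ for $y\neq0$ and $0$ for $y=0$; constants $\mathbf 0,\mathbf 1,\mathbf n,-\mathbf 1$ denote $0,1,n,2^n-1$; $\max,\min$ usual; $\cap$ bitwise AND and $\mathcal N$ bitwise complement on $n$-bit binary representations. For $a,t\in\omega$ and an integer $i$, $a[i,t]$ denotes the $i$-th digit of $a$ in base $2^{2^t}$ (so $a=\sum_i a[i,t]2^{i2^t}$; $a[i,t]=0$ for $i<0$). For $d\ge t$ and a $k$-ary function symbol $\mathbf f$, the function $\mathbf f_{d,t}$ on $\mathbf M_d$ is defined by: $\mathbf f_{d,t}(a_0,\dots,a_{k-1})$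 is the unique $b\in\mathbf M_d$ such that for all $i<2^{d-t}$, $\mathbf M_t\models\mathbf f(a_0[i,t],\dots,a_{k-1}[i,t])=b[i,t]$ (i.e., $\mathbf f$ is applied componentwise to the vectors of base-$2^{2^t}$ digits). *)

(* Defs.v *)
From mathcomp Require Import all_boot.

Set Implicit Arguments.
Unset Strict Implicit.
Unset Printing Implicit Defensive.

(* The constants 0, 1, -1, n are the nullary function symbols of the language. *)
Inductive symbol : Type :=
  | Zero | One | MinusOne | Len
  | Compl | Pow
  | Add | Mul | Div | Max | Min | Cap.

Definition arity (f : symbol) : nat :=
  match f with
  | Zero | One | MinusOne | Len => 0
  | Compl | Pow => 1
  | Add | Mul | Div | Max | Min | Cap => 2
  end.

(* Terms and formulas whose free variables are among x_0, ..., x_(n-1)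
   (de Bruijn indices: a quantifier binds variable 0 of its body and shifts the
   other variables by one). *)
Inductive term (n : nat) : Type :=
  | Var of 'I_n
  | App (f : symbol) of ('I_(arity f) -> term n).

Inductive formula (n : nat) : Type :=
  | FEq of term n & term n
  | FNot of formula n
  | FAnd of formula n & formula n
  | FOr of formula n & formula n
  | FImp of formula n & formula n
  | FEx of formula n.+1
  | FAll of formula n.+1.

Fixpoint quantifier_free n (phi : formula n) : bool :=
  match phi with
  | FEq _ _ => true
  | FNot p => quantifier_free p
  | FAnd p q | FOr p q | FImp p q => quantifier_free p && quantifier_free q
  | FEx _ | FAll _ => false
  end.

(* A block of existential quantifiers in front of a quantifier-free formula. *)
Fixpoint existential n (phi : formula n) : bool :=
  if phi is FEx p then existential p else quantifier_free phi.

Definition M (d : nat) : finType := 'I_(2 ^ 2 ^ d).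

Lemma M_gt0 d : 0 < 2 ^ 2 ^ d.
Proof. by rewrite expn_gt0. Qed.

Definition inM (d x : nat) : M d := Ordinal (ltn_pmod x (M_gt0 d)).

Definition bit (x i : nat) : bool := odd (x %/ 2 ^ i).

Definition bitand (n x y : nat) : nat :=
  \sum_(i < n) (bit x i && bit y i) * 2 ^ i.

Definition bitcompl (n x : nat) : nat :=
  \sum_(i < n) (~~ bit x i) * 2 ^ i.

Definition op1 d (g : nat -> nat) (a : 1.-tuple (M d)) : M d :=
  inM d (g (tnth a ord0)).

Definition op2 d (g : nat -> nat -> nat) (a : 2.-tuple (M d)) : M d :=
  inM d (g (tnth a ord0) (tnth a ord_max)).

(* The reduction modulo 2 ^ 2 ^ d performed by inM is effective only for Add
   and Mul; the other values are already in range. Note x %/ 0 = 0. *)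
Definition interp (d : nat) (f : symbol) : (arity f).-tuple (M d) -> M d :=
  let n := 2 ^ d in
  match f return (arity f).-tuple (M d) -> M d with
  | Zero => fun=> inM d 0
  | One => fun=> inM d 1
  | MinusOne => fun=> inM d (2 ^ n - 1)
  | Len => fun=> inM d n
  | Compl => op1 (bitcompl n)
  | Pow => op1 (fun x => minn (2 ^ x) (2 ^ n - 1))
  | Add => op2 addn
  | Mul => op2 muln
  | Div => op2 divn
  | Max => op2 maxn
  | Min => op2 minn
  | Cap => op2 (bitand n)
  end.
Arguments interp {d} f a.

Fixpoint eval d n (e : n.-tuple (M d)) (u : term n) : M d :=
  match u with
  | Var i => tnth e i
  | App f args => interp f [tuple eval e (args i) | i < arity f]
  end.

Fixpoint holds d n (e : n.-tuple (M d)) (phi : formula n) : Prop :=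
  match phi with
  | FEq u v => eval e u = eval e v
  | FNot p => ~ holds e p
  | FAnd p q => holds e p /\ holds e q
  | FOr p q => holds e p \/ holds e q
  | FImp p q => holds e p -> holds e q
  | FEx p => exists x : M d, holds [tuple of x :: e] p
  | FAll p => forall x : M d, holds [tuple of x :: e] p
  end.

(* a[i, t], for i >= 0. *)
Definition digit (t a i : nat) : M t := inM t (a %/ 2 ^ (i * 2 ^ t)).

Definition componentwise_spec d t (f : symbol) (a : (arity f).-tuple (M d))
    (b : M d) : bool :=
  [forall i : 'I_(2 ^ (d - t)),
     interp f [tuple digit t (tnth a j) i | j < arity f] == digit t b i].
Arguments componentwise_spec {d} t f a b.

(* f_(d,t)(a) is the unique b satisfying the specification; for t <= d the
   default value is irrelevant by componentwiseP below. *)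
Definition componentwise d t (f : symbol) (a : (arity f).-tuple (M d)) : M d :=
  odflt (inM d 0) [pick b | componentwise_spec t f a b].
Arguments componentwise {d} t f a.

Lemma digits_ub t m (F : nat -> nat) :
  (forall i, F i < 2 ^ 2 ^ t) ->
  \sum_(i < m) F i * 2 ^ (i * 2 ^ t) < 2 ^ (m * 2 ^ t).
Proof.
move=> FP; elim: m => [|m IH]; first by rewrite big_ord0 expn_gt0.
rewrite big_ord_recr /= mulSn expnD.
apply: (@leq_trans (2 ^ (m * 2 ^ t) + F m * 2 ^ (m * 2 ^ t))).
  by rewrite ltn_add2r.
by rewrite -mulSn leq_mul2r FP orbT.
Qed.

Lemma digits_sum t m (F : nat -> nat) i :
  (forall i, F i < 2 ^ 2 ^ t) -> i < m ->
  ((\sum_(j < m) F j * 2 ^ (j * 2 ^ t)) %/ 2 ^ (i * 2 ^ t)) %% 2 ^ 2 ^ t = F i.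
Proof.
elim: m F i => [//|m IH] F i FP.
have -> : \sum_(j < m.+1) F j * 2 ^ (j * 2 ^ t) =
    (\sum_(j < m) F j.+1 * 2 ^ (j * 2 ^ t)) * 2 ^ 2 ^ t + F 0.
  rewrite big_ord_recl mul0n expn0 muln1 addnC big_distrl; congr (_ + _).
  by apply: eq_bigr => j _ /=; rewrite -mulnA -expnD addnC -mulSn.
case: i => [_|i lt_im]; first by rewrite mul0n divn1 modnMDl modn_small.
rewrite mulSn expnD divnMA divnMDl ?expn_gt0 // (divn_small (FP 0)) addn0.
exact: (IH (fun j => F j.+1)).
Qed.

Lemma digits_inj t m x y :
  x < 2 ^ (m * 2 ^ t) -> y < 2 ^ (m * 2 ^ t) ->
  (forall i, i < m -> digit t x i = digit t y i) -> x = y.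
Proof.
elim: m x y => [|m IH] x y; first by rewrite mul0n !ltnS !leqn0 => /eqP-> /eqP->.
rewrite mulSn expnD => ltx lty E.
rewrite (divn_eq x (2 ^ 2 ^ t)) (divn_eq y (2 ^ 2 ^ t)).
have /(congr1 val) /= := E 0 isT; rewrite mul0n !divn1 => ->.
congr (_ * _ + _); apply: IH; rewrite ?ltn_divLR ?expn_gt0 1?mulnC //.
move=> i lt_im; apply: val_inj; have /(congr1 val) /= := E i.+1 lt_im.
by rewrite mulSn expnD !divnMA.
Qed.

Lemma componentwiseP d t f (a : (arity f).-tuple (M d)) b :
  t <= d -> reflect (componentwise t f a = b) (componentwise_spec t f a b).
Proof.
move=> le_td.
have Edt : 2 ^ (d - t) * 2 ^ t = 2 ^ d by rewrite -expnD subnK.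
pose F i := val (interp f [tuple digit t (tnth a j) i | j < arity f]).
have FP i : F i < 2 ^ 2 ^ t by apply: ltn_ord.
have spec0 : componentwise_spec t f a
    (inM d (\sum_(i < 2 ^ (d - t)) F i * 2 ^ (i * 2 ^ t))).
  apply/forallP => i; apply/eqP/val_inj => /=.
  by rewrite [X in X %/ _]modn_small ?digits_sum // -Edt digits_ub.
have uniq_spec c c' :
    componentwise_spec t f a c -> componentwise_spec t f a c' -> c = c'.
  move=> /forallP H /forallP H'; apply: val_inj.
  apply: (@digits_inj t (2 ^ (d - t))); rewrite ?Edt ?ltn_ord // => i lt_i.
  by rewrite -(eqP (H (Ordinal lt_i))) -(eqP (H' (Ordinal lt_i))).
have specC : componentwise_spec t f a (componentwise t f a).
  by rewrite /componentwise; case: pickP => //= H; rewrite H in spec0.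
by apply: (iffP idP) => [/(uniq_spec _ _ specC) | <-].
Qed.

Lemma inM_level d t : t <= d -> val (inM d t) = t.
Proof.
move=> le_td; rewrite /= modn_small //; apply: leq_ltn_trans le_td _.
by apply: ltn_trans (ltn_expl d _) (ltn_expl _ _).
Qed.

(* Main.v *)
(** For t = d the function f_(d,t) is f itself. For t < d it is the value of a
term in the arguments and t, so that the formula can be taken
quantifier-free. With B = 2 ^ 2 ^ t, the quotient of -1 by B + 1 is a mask
selecting the digits of even index. After masking, every digit is followed by
a zero digit, which receives the carry of an addition: adding the even and the
odd digits separately gives componentwise addition, and reading off the carries
of a + (B - 1 - b) compares all digits at once. The comparison bits times
B - 1 form a mask selecting the larger or the smaller digits. *)

Require Import Defs.
From mathcomp Require Import all_boot zify.

Set Implicit Arguments.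
Unset Strict Implicit.
Unset Printing Implicit Defensive.

Definition digitn (B x i : nat) : nat := x %/ B ^ i %% B.

(* The carry into, not out of, position i. *)
Definition carry (B x y i : nat) : bool := B ^ i <= x %% B ^ i + y %% B ^ i.

Section PositionalNotation.

Variable B : nat.
Hypothesis B_gt0 : 0 < B.
Implicit Types (x y i j k m : nat) (F : nat -> nat).

Let Bi_gt0 i : 0 < B ^ i.
Proof. by rewrite expn_gt0 B_gt0. Qed.

Lemma ltn_digitn x i : digitn B x i < B.
Proof. exact: ltn_pmod. Qed.

Lemma digitn_divn x k i : digitn B (x %/ B ^ k) i = digitn B x (k + i).
Proof. by rewrite /digitn expnD divnMA. Qed.

Lemma digitn_modn m x i : i < m -> digitn B (x %% B ^ m) i = digitn B x i.
Proof.
by move=> lt_im; rewrite /digitn !modn_divl -expnS modn_dvdm ?dvdn_exp2l.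
Qed.

Lemma modn_expnS x i : x %% B ^ i.+1 = digitn B x i * B ^ i + x %% B ^ i.
Proof.
rewrite [LHS](divn_eq _ (B ^ i)) {1}expnS -modn_divl.
by rewrite modn_dvdm ?dvdn_exp2l.
Qed.

Lemma eq_modn_digitn m x y :
  (forall i, i < m -> digitn B x i = digitn B y i) -> x = y %[mod B ^ m].
Proof.
elim: m => [|m IH] eq_xy; first by rewrite !modn1.
by rewrite !modn_expnS eq_xy // IH // => i lt_im; apply/eq_xy/ltnW.
Qed.

Lemma digitn_inj m x y : x < B ^ m -> y < B ^ m ->
  (forall i, i < m -> digitn B x i = digitn B y i) -> x = y.
Proof. by move=> ltx lty /eq_modn_digitn; rewrite !modn_small. Qed.

Lemma digitn_base_expn k x i j : j < k ->
  digitn B (digitn (B ^ k) x i) j = digitn B x (i * k + j).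
Proof.
by move=> lt_jk; rewrite digitn_modn // -expnM mulnC digitn_divn.
Qed.

Lemma ltn_sum_digits F m :
  (forall i, F i < B) -> \sum_(i < m) F i * B ^ i < B ^ m.
Proof.
move=> ltFB; elim: m => [|m IH]; first by rewrite big_ord0.
rewrite big_ord_recr expnS; apply: leq_trans (leq_mul (ltFB m) (leqnn _)).
by rewrite mulSn ltn_add2r.
Qed.

Lemma digitn_sum F m i : (forall j, F j < B) -> i < m ->
  digitn B (\sum_(j < m) F j * B ^ j) i = F i.
Proof.
move=> ltFB; elim: m => // m IH; rewrite big_ord_recr /= addnC.
rewrite ltnS leq_eqVlt => /predU1P[->|lt_im].
  by rewrite /digitn divnMDl // divn_small ?ltn_sum_digits // addn0 modn_small.
by rewrite -(digitn_modn _ lt_im) modnMDl digitn_modn ?IH.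
Qed.

Lemma digitnD x y i :
  digitn B (x + y) i = (digitn B x i + digitn B y i + carry B x y i) %% B.
Proof. by rewrite /digitn divnD // -[LHS]modnDml -[RHS]modnDml modnDm. Qed.

Lemma carry0 x y : carry B x y 0 = false.
Proof. by rewrite /carry !modn1. Qed.

Lemma carryS x y i :
  carry B x y i.+1 = (B <= digitn B x i + digitn B y i + carry B x y i).
Proof.
rewrite /carry !modn_expnS expnS.
have := ltn_pmod x (Bi_gt0 i); have := ltn_pmod y (Bi_gt0 i).
by case: leqP => /= ? ? ?; apply/idP/idP; nia.
Qed.

Lemma carry_digits0 x y i : 1 < B ->
  digitn B x i = 0 -> digitn B y i = 0 -> carry B x y i.+1 = false.
Proof. by rewrite carryS => B_gt1 -> ->; case: carry; lia. Qed.

Lemma carry_small x y i :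
  (forall j, j < i -> digitn B x j + digitn B y j < B) -> carry B x y i = false.
Proof.
elim: i => [|i IH] small; first exact: carry0.
rewrite carryS IH ?addn0 => [|j lt_ji]; last exact/small/ltnW.
by rewrite leqNgt small.
Qed.

Lemma digitnD_small x y i :
  (forall j, j <= i -> digitn B x j + digitn B y j < B) ->
  digitn B (x + y) i = digitn B x i + digitn B y i.
Proof.
move=> small; rewrite digitnD carry_small => [|j /ltnW/small//].
by rewrite addn0 modn_small ?small.
Qed.

Lemma digitnM_small k x i : (forall j, j <= i -> k * digitn B x j < B) ->
  digitn B (k * x) i = k * digitn B x i.
Proof.
elim: k i => [|k IH] i small; first by rewrite !mul0n /digitn div0n mod0n.
have IHj j : j <= i -> digitn B (k * x) j = k * digitn B x j.
  move=> le_ji; apply: IH => l le_lj.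
  by have := small l (leq_trans le_lj le_ji); lia.
by rewrite mulSn digitnD_small ?IHj // => j le_ji; rewrite IHj -?mulSn ?small.
Qed.

Lemma expn_sub1_sum m : B ^ m - 1 = \sum_(i < m) (B - 1) * B ^ i.
Proof. by rewrite !subn1 predn_exp big_distrr. Qed.

Lemma digitn_expn_sub1 m i : i < m -> digitn B (B ^ m - 1) i = B - 1.
Proof.
by rewrite expn_sub1_sum; apply: (@digitn_sum (fun=> B - 1)) => _; lia.
Qed.

Lemma digitn_repunit m i : 1 < B -> i < m ->
  digitn B ((B ^ m - 1) %/ (B - 1)) i = 1.
Proof.
move=> B_gt1 lt_im; rewrite expn_sub1_sum -big_distrr mulKn ?subn_gt0 //=.
rewrite -[RHS](@digitn_sum (fun=> 1) m i) //.
by congr digitn; apply: eq_bigr => j _; rewrite mul1n.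
Qed.

Lemma expn_double_sub1 k :
  B ^ k.*2 - 1 = (\sum_(j < k.*2) ~~ odd j * (B - 1) * B ^ j) * B.+1.
Proof.
elim: k => [|k IH]; first by rewrite big_ord0.
rewrite doubleS !big_ord_recr /= odd_double !mul0n addn0 mul1n mulnDl -IH.
rewrite !expnS; move: (B ^ _) (Bi_gt0 k.*2) => P P_gt0.
by rewrite -[B](subnK B_gt0) addnK; nia.
Qed.

Lemma digitn_even_mask k i : i < k.*2 ->
  digitn B ((B ^ k.*2 - 1) %/ B.+1) i = ~~ odd i * (B - 1).
Proof.
rewrite expn_double_sub1 mulnK //.
by apply: (@digitn_sum (fun j => ~~ odd j * (B - 1))) => j; case: odd; lia.
Qed.

End PositionalNotation.

Section BitwiseOperations.

Implicit Types (n k m x y i : nat) (c : bool).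

Lemma digitn2 x i : digitn 2 x i = bit x i.
Proof. exact: modn2. Qed.

Lemma bit_inj n x y : x < 2 ^ n -> y < 2 ^ n ->
  (forall i, i < n -> bit x i = bit y i) -> x = y.
Proof.
move=> ltx lty eq_bits; apply: digitn_inj ltx lty _ => // i lt_in.
by rewrite !digitn2 eq_bits.
Qed.

Lemma bit_digitn k x i j : j < k ->
  bit (digitn (2 ^ k) x i) j = bit x (i * k + j).
Proof.
by move=> lt_jk; apply: (can_inj oddb); rewrite -!digitn2 digitn_base_expn.
Qed.

Lemma ltn_sum_bits n (b : nat -> bool) : \sum_(i < n) b i * 2 ^ i < 2 ^ n.
Proof. by apply: (@ltn_sum_digits 2 isT b) => i; case: (b i). Qed.

Lemma bit_sum n (b : nat -> bool) i :
  i < n -> bit (\sum_(j < n) b j * 2 ^ j) i = b i.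
Proof.
move=> lt_in; apply: (can_inj oddb); rewrite -digitn2.
by rewrite (@digitn_sum 2 isT b) // => j; case: (b j).
Qed.

Lemma sum_bits n x : x < 2 ^ n -> \sum_(i < n) bit x i * 2 ^ i = x.
Proof.
move=> ltx; apply: bit_inj ltx _; first exact: ltn_sum_bits.
by move=> i lt_in; rewrite bit_sum.
Qed.

Lemma bitand_lt n x y : bitand n x y < 2 ^ n.
Proof. exact: (ltn_sum_bits n (fun i => bit x i && bit y i)). Qed.

Lemma bit_bitand n x y i : i < n -> bit (bitand n x y) i = bit x i && bit y i.
Proof. exact: (@bit_sum n (fun i => bit x i && bit y i)). Qed.

Lemma bitcompl_lt n x : bitcompl n x < 2 ^ n.
Proof. exact: (ltn_sum_bits n (fun i => ~~ bit x i)). Qed.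

Lemma bit_bitcompl n x i : i < n -> bit (bitcompl n x) i = ~~ bit x i.
Proof. exact: (@bit_sum n (fun i => ~~ bit x i)). Qed.

Lemma bitcomplE n x : x < 2 ^ n -> bitcompl n x = 2 ^ n - 1 - x.
Proof.
move=> ltx; suff <-: bitcompl n x + x = 2 ^ n - 1 by rewrite addnK.
rewrite -{2}(sum_bits ltx) -big_split expn_sub1_sum //.
by apply: eq_bigr => i _; case: bit; rewrite /= ?addn0.
Qed.

Lemma bitand_mask k x c : x < 2 ^ k -> bitand k x (c * (2 ^ k - 1)) = c * x.
Proof.
move=> ltx; apply: (@bit_inj k) => [||i lt_ik]; first exact: bitand_lt.
  by case: c; rewrite ?mul1n ?expn_gt0.
rewrite bit_bitand //; case: c; last by rewrite !mul0n /bit div0n andbF.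
suff: bit (2 ^ k - 1) i = 1 :> nat by rewrite !mul1n; case: bit; rewrite ?andbT.
by rewrite -digitn2 digitn_expn_sub1.
Qed.

Lemma bit_position_ltn k m i j : i < m -> j < k -> i * k + j < m * k.
Proof. nia. Qed.

Lemma digitn_bitand k m x y i : i < m ->
  digitn (2 ^ k) (bitand (m * k) x y) i =
  bitand k (digitn (2 ^ k) x i) (digitn (2 ^ k) y i).
Proof.
move=> lt_im; apply: (@bit_inj k) => [||j lt_jk].
- by rewrite ltn_digitn ?expn_gt0.
- exact: bitand_lt.
- by rewrite bit_bitand // !bit_digitn // bit_bitand ?bit_position_ltn.
Qed.

Lemma digitn_bitcompl k m x i : i < m ->
  digitn (2 ^ k) (bitcompl (m * k) x) i = bitcompl k (digitn (2 ^ k) x i).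
Proof.
move=> lt_im; apply: (@bit_inj k) => [||j lt_jk].
- by rewrite ltn_digitn ?expn_gt0.
- exact: bitcompl_lt.
- by rewrite bit_bitcompl // !bit_digitn // bit_bitcompl ?bit_position_ltn.
Qed.

End BitwiseOperations.

Lemma expn_levels d t : t <= d -> 2 ^ (d - t) * 2 ^ t = 2 ^ d.
Proof. by move=> le_td; rewrite -expnD subnK. Qed.

Lemma expn2_levels d t : t <= d -> (2 ^ 2 ^ t) ^ 2 ^ (d - t) = 2 ^ 2 ^ d.
Proof. by move=> le_td; rewrite -expnM mulnC expn_levels. Qed.

Lemma expn2_gt1 d : 1 < 2 ^ 2 ^ d.
Proof. by rewrite -{1}(expn0 2) ltn_exp2l ?expn_gt0. Qed.

Lemma digitE t x i : digit t x i = digitn (2 ^ 2 ^ t) x i :> nat.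
Proof. by rewrite /digitn -expnM mulnC. Qed.

Section Interpretation.

Variable d : nat.
Local Notation N := (2 ^ 2 ^ d).

Lemma interp_zero a : @interp d Zero a = 0 :> nat.
Proof. exact: mod0n. Qed.

Lemma interp_one a : @interp d One a = 1 :> nat.
Proof. by rewrite /= modn_small ?expn2_gt1. Qed.

Lemma interp_minus_one a : @interp d MinusOne a = N - 1 :> nat.
Proof. by rewrite /= modn_small // ltn_subrL M_gt0. Qed.

Lemma interp_len a : @interp d Len a = 2 ^ d :> nat.
Proof. by rewrite /= modn_small // ltn_expl. Qed.

Lemma interp_compl a :
  @interp d Compl a = bitcompl (2 ^ d) (tnth a ord0) :> nat.
Proof. by rewrite /= modn_small ?bitcompl_lt. Qed.

Lemma interp_pow a : @interp d Pow a = minn (2 ^ tnth a ord0) (N - 1) :> nat.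
Proof. by rewrite /= modn_small // gtn_min ltn_subrL M_gt0 orbT. Qed.

Lemma interp_add a :
  @interp d Add a = (tnth a ord0 + tnth a ord_max) %% N :> nat.
Proof. by []. Qed.

Lemma interp_mul a :
  @interp d Mul a = (tnth a ord0 * tnth a ord_max) %% N :> nat.
Proof. by []. Qed.

Lemma interp_div a : @interp d Div a = tnth a ord0 %/ tnth a ord_max :> nat.
Proof.
by rewrite /= modn_small // (leq_ltn_trans (leq_div _ _)) ?ltn_ord.
Qed.

Lemma interp_max a :
  @interp d Max a = maxn (tnth a ord0) (tnth a ord_max) :> nat.
Proof. by rewrite /= modn_small // gtn_max !ltn_ord. Qed.

Lemma interp_min a :
  @interp d Min a = minn (tnth a ord0) (tnth a ord_max) :> nat.
Proof. by rewrite /= modn_small // gtn_min ltn_ord. Qed.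

Lemma interp_cap a :
  @interp d Cap a = bitand (2 ^ d) (tnth a ord0) (tnth a ord_max) :> nat.
Proof. by rewrite /= modn_small ?bitand_lt. Qed.

End Interpretation.

Definition app n f (us : (arity f).-tuple (term n)) : term n := App (tnth us).
Arguments app {n} f us.

Section Evaluation.

Variables (d n : nat) (e : n.-tuple (M d)).
Local Notation N := (2 ^ 2 ^ d).

Lemma eval_app f us : eval e (app f us) = interp f (map_tuple (eval e) us).
Proof.
by congr (interp f _); apply: eq_from_tnth => i; rewrite tnth_mktuple tnth_map.
Qed.

Lemma eval_minus_one : eval e (app MinusOne [tuple]) = N - 1 :> nat.
Proof. by rewrite eval_app interp_minus_one. Qed.

Lemma eval_pow_small u :
  eval e u < 2 ^ d -> eval e (app Pow [tuple u]) = 2 ^ eval e u :> nat.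
Proof.
move=> lt_u; rewrite eval_app interp_pow tnth_map; apply/minn_idPl.
by rewrite leq_subRL ?M_gt0 // add1n ltn_exp2l.
Qed.

Lemma eval_compl u :
  eval e (app Compl [tuple u]) = bitcompl (2 ^ d) (eval e u) :> nat.
Proof. by rewrite eval_app interp_compl tnth_map. Qed.

Lemma eval_add u v :
  eval e (app Add [tuple u; v]) = (eval e u + eval e v) %% N :> nat.
Proof. by rewrite eval_app interp_add !tnth_map. Qed.

Lemma eval_mul u v :
  eval e (app Mul [tuple u; v]) = (eval e u * eval e v) %% N :> nat.
Proof. by rewrite eval_app interp_mul !tnth_map. Qed.

Lemma eval_div u v :
  eval e (app Div [tuple u; v]) = eval e u %/ eval e v :> nat.
Proof. by rewrite eval_app interp_div !tnth_map. Qed.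

Lemma eval_cap u v :
  eval e (app Cap [tuple u; v]) = bitand (2 ^ d) (eval e u) (eval e v) :> nat.
Proof. by rewrite eval_app interp_cap !tnth_map. Qed.

End Evaluation.

Lemma leq_add_compl B a b : a < B -> b < B -> (B <= a + (B - 1 - b)) = (b < a).
Proof. lia. Qed.

Section VectorOperations.

Variable n : nat.
Implicit Types u v w : term n.

Definition masked_sum w u v : term n :=
  app Add [tuple app Cap [tuple u; w]; app Cap [tuple v; w]].

Definition blend w u v : term n :=
  app Add [tuple app Cap [tuple u; w]; app Cap [tuple v; app Compl [tuple w]]].

Variables (d t : nat) (e : n.-tuple (M d)).
Hypothesis le_td : t <= d.
Local Notation B := (2 ^ 2 ^ t).
Local Notation m := (2 ^ (d - t)).
Local Notation D u i := (digitn B (eval e u) i).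

Let B_gt1 : 1 < B := expn2_gt1 t.
Let B_gt0 : 0 < B := ltnW B_gt1.

Lemma digitn_mod_level x i :
  i < m -> digitn B (x %% 2 ^ 2 ^ d) i = digitn B x i.
Proof. by move=> lt_im; rewrite -(expn2_levels le_td) digitn_modn. Qed.

Lemma digit_add u v i :
  i < m -> D (app Add [tuple u; v]) i = digitn B (eval e u + eval e v) i.
Proof. by move=> lt_im; rewrite eval_add digitn_mod_level. Qed.

Lemma digit_mul_small u v i :
  (forall j, j < m -> eval e u * D v j < B) -> i < m ->
  D (app Mul [tuple u; v]) i = eval e u * D v i.
Proof.
move=> small lt_im; rewrite eval_mul digitn_mod_level //.
by apply: digitnM_small => // j le_ji; apply/small/leq_ltn_trans/lt_im.
Qed.

Lemma digit_cap u v i :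
  i < m -> D (app Cap [tuple u; v]) i = bitand (2 ^ t) (D u i) (D v i).
Proof.
move=> lt_im; rewrite eval_cap -[X in bitand X](expn_levels le_td).
exact: digitn_bitand.
Qed.

Lemma digit_compl u i : i < m -> D (app Compl [tuple u]) i = B - 1 - D u i.
Proof.
move=> lt_im; rewrite eval_compl -[X in bitcompl X](expn_levels le_td).
by rewrite digitn_bitcompl // bitcomplE ?ltn_digitn.
Qed.

Definition digit_mask (c : pred nat) w :=
  forall i, i < m -> D w i = c i * (B - 1).

Lemma digit_mask_compl c w :
  digit_mask c w -> digit_mask (predC c) (app Compl [tuple w]).
Proof.
by move=> mask_w i lt_im; rewrite digit_compl // mask_w //=; case: (c i); lia.
Qed.

Lemma digit_cap_mask c w u i :
  digit_mask c w -> i < m -> D (app Cap [tuple u; w]) i = c i * D u i.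
Proof.
by move=> mask_w lt_im; rewrite digit_cap // mask_w // bitand_mask ?ltn_digitn.
Qed.

Lemma digit_blend c w u v i : digit_mask c w -> i < m ->
  D (blend w u v) i = if c i then D u i else D v i.
Proof.
move=> mask_w lt_im; have mask_compl := digit_mask_compl mask_w.
have digits j : j < m ->
    (D (app Cap [tuple u; w]) j = c j * D u j) *
    (D (app Cap [tuple v; app Compl [tuple w]]) j = ~~ c j * D v j).
  move=> lt_jm; rewrite (digit_cap_mask _ mask_w) //.
  by rewrite (digit_cap_mask _ mask_compl).
rewrite digit_add // digitnD_small // => [|j le_ji].
  by rewrite !digits //; case: (c i); rewrite mul0n mul1n ?addn0.
rewrite !digits ?(leq_ltn_trans le_ji) //.
by case: (c j); rewrite mul0n mul1n ?addn0 ltn_digitn.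
Qed.

Section SparseMask.

Variables (c : pred nat) (w : term n).
Hypotheses (mask_w : digit_mask c w) (sparse_c : forall i, c i -> ~~ c i.+1).

(* A masked digit is preceded by a zero digit, which absorbs any carry. *)
Lemma carry_masked u v i : i < m -> c i ->
  carry B (eval e (app Cap [tuple u; w])) (eval e (app Cap [tuple v; w])) i
  = false.
Proof.
case: i => [|i] lt_im ci; first exact: carry0.
have Nci : c i = false by apply: contraTF ci => /sparse_c.
by apply: carry_digits0; rewrite // (digit_cap_mask _ mask_w) ?Nci // ltnW.
Qed.

Lemma digit_masked_sum u v i :
  i < m -> c i -> D (masked_sum w u v) i = (D u i + D v i) %% B.
Proof.
move=> lt_im ci; rewrite digit_add // digitnD // carry_masked // addn0.
by rewrite !(digit_cap_mask _ mask_w) // ci !mul1n.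
Qed.

Lemma digit_masked_sum_carry u v i :
  i.+1 < m -> c i -> D (masked_sum w u v) i.+1 = (B <= D u i + D v i).
Proof.
move=> lt_Sim ci; have lt_im := ltnW lt_Sim.
rewrite digit_add // digitnD // carryS // carry_masked //.
rewrite !(digit_cap_mask _ mask_w) // ci (negbTE (sparse_c ci)).
rewrite !mul0n !mul1n !addn0 add0n modn_small //.
exact: leq_ltn_trans (leq_b1 _) B_gt1.
Qed.

End SparseMask.

End VectorOperations.

(* z is meant to denote t, and B = 2 ^ 2 ^ t. *)
Section LevelTerms.

Variables (n : nat) (z : term n).
Implicit Types u v w : term n.

Definition base : term n := app Pow [tuple app Pow [tuple z]].

Definition max_digit : term n := app Add [tuple base; app MinusOne [tuple]].

Definition repunit : term n := app Div [tuple app MinusOne [tuple]; max_digit].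

(* (B ^ 2k - 1) / (B + 1) = (B - 1) (1 + B ^ 2 + ... + B ^ (2k - 2)) *)
Definition even_mask : term n :=
  app Div [tuple app MinusOne [tuple]; app Add [tuple base; app One [tuple]]].

Definition odd_mask : term n := app Compl [tuple even_mask].

Definition shift u : term n := app Div [tuple u; base].

Definition vector_sum u v : term n :=
  blend even_mask (masked_sum even_mask u v) (masked_sum odd_mask u v).

(* The i-th digit of u exceeds that of v iff u_i + (B - 1 - v_i) carries. Odd
   digits are shifted to even positions first, lest the topmost carry be lost
   in the reduction modulo 2 ^ 2 ^ d. *)
Definition vector_gt u v : term n :=
  let compl_v := app Compl [tuple v] in
  blend even_mask (shift (masked_sum even_mask u compl_v))
    (masked_sum even_mask (shift u) (shift compl_v)).

Definition gt_mask u v : term n := app Mul [tuple max_digit; vector_gt u v].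

Variables (d t : nat) (e : n.-tuple (M d)).
Hypotheses (lt_td : t < d) (z_t : eval e z = t :> nat).
Local Notation B := (2 ^ 2 ^ t).
Local Notation m := (2 ^ (d - t)).
Local Notation D u i := (digitn B (eval e u) i).

Let le_td : t <= d := ltnW lt_td.
Let B_gt1 : 1 < B := expn2_gt1 t.
Let B_gt0 : 0 < B := ltnW B_gt1.

Lemma digit_count_double : m = (2 ^ (d - t).-1).*2.
Proof. by rewrite -mul2n -expnS prednK // subn_gt0. Qed.

Lemma eval_base : eval e base = B :> nat.
Proof.
have eval_pow_z : eval e (app Pow [tuple z]) = 2 ^ t :> nat.
  by rewrite eval_pow_small z_t // (leq_ltn_trans le_td) // ltn_expl.
by rewrite eval_pow_small eval_pow_z // ltn_exp2l.
Qed.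

Lemma eval_max_digit : eval e max_digit = B - 1 :> nat.
Proof.
rewrite eval_add eval_base eval_minus_one addnBA ?M_gt0 //.
rewrite -addnBAC ?M_gt0 // modnDr modn_small //.
by apply: leq_ltn_trans (leq_subr _ _) _; rewrite !ltn_exp2l.
Qed.

Lemma digit_repunit i : i < m -> D repunit i = 1.
Proof.
rewrite eval_div eval_minus_one eval_max_digit -(expn2_levels le_td).
exact: digitn_repunit.
Qed.

Lemma digit_shift u i : D (shift u) i = D u i.+1.
Proof. by rewrite eval_div eval_base -(expn1 B) digitn_divn expn1. Qed.

Lemma digit_even_mask : digit_mask t e (predC odd) even_mask.
Proof.
move=> i lt_im; rewrite eval_div eval_minus_one eval_add eval_base.
rewrite eval_app interp_one addn1 modn_small; last first.
  apply: (@leq_trans (2 ^ (2 ^ t).*2)); first by rewrite -addnn expnD; nia.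
  by rewrite leq_exp2l // -mul2n -expnS leq_exp2l.
rewrite -(expn2_levels le_td) digit_count_double digitn_even_mask //.
by rewrite -digit_count_double.
Qed.

Lemma digit_odd_mask : digit_mask t e odd odd_mask.
Proof.
move=> i lt_im; rewrite (digit_mask_compl le_td digit_even_mask) //=.
by rewrite negbK.
Qed.

Let sparse_even i : predC odd i -> ~~ predC odd i.+1.
Proof. by rewrite /= !negbK. Qed.

Let sparse_odd i : odd i -> ~~ odd i.+1.
Proof. by rewrite /= negbK. Qed.

Lemma digit_vector_sum u v i :
  i < m -> D (vector_sum u v) i = (D u i + D v i) %% B.
Proof.
move=> lt_im; rewrite (digit_blend le_td _ _ digit_even_mask) //.
case: ifP => [even_i|/negbFE odd_i].
  exact: (digit_masked_sum le_td digit_even_mask sparse_even).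
exact: (digit_masked_sum le_td digit_odd_mask sparse_odd).
Qed.

Lemma digit_vector_gt u v i : i < m -> D (vector_gt u v) i = (D v i < D u i).
Proof.
move=> lt_im; rewrite (digit_blend le_td _ _ digit_even_mask) //=.
case: ifP => [even_i|/negbFE odd_i].
  have lt_Sim : i.+1 < m.
    rewrite ltn_neqAle lt_im andbT; apply: contraNneq even_i => /(congr1 odd).
    by rewrite digit_count_double odd_double /= => /negbFE.
  rewrite digit_shift.
  rewrite (digit_masked_sum_carry le_td digit_even_mask sparse_even) //.
  by rewrite digit_compl // leq_add_compl ?ltn_digitn.
case: i lt_im odd_i => // i lt_im even_i.
rewrite (digit_masked_sum_carry le_td digit_even_mask sparse_even) //.
by rewrite !digit_shift digit_compl // leq_add_compl ?ltn_digitn.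
Qed.

Lemma digit_gt_mask u v : digit_mask t e (fun i => D v i < D u i) (gt_mask u v).
Proof.
move=> i lt_im.
rewrite digit_mul_small // => [|j lt_jm]; rewrite eval_max_digit.
  by rewrite digit_vector_gt // mulnC.
by rewrite digit_vector_gt //; case: ltnP; lia.
Qed.

End LevelTerms.

Definition level_var k : 'I_(k + 2) := rshift k ord_max.
Definition value_var k : 'I_(k + 2) := rshift k ord0.
Definition arg_var k (i : 'I_k) : 'I_(k + 2) := lshift 2 i.

Definition env d k (a : k.-tuple (M d)) (b : M d) (t : nat) :
    (k + 2).-tuple (M d) :=
  [tuple of a ++ [:: b; inM d t]].

Section Environment.

Variables (d k t : nat) (a : k.-tuple (M d)) (b : M d).

Lemma eval_level : t <= d -> eval (env a b t) (Var (level_var k)) = t :> nat.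
Proof. by move=> le_td; rewrite [eval _ _]tnth_rshift inM_level. Qed.

Lemma eval_pow_level : t <= d ->
  eval (env a b t) (app Pow [tuple Var (level_var k)]) = 2 ^ t :> nat.
Proof.
move=> le_td; rewrite eval_pow_small eval_level //.
by rewrite (leq_ltn_trans le_td) // ltn_expl.
Qed.

Lemma eval_value : eval (env a b t) (Var (value_var k)) = b.
Proof. exact: tnth_rshift. Qed.

Lemma eval_arg i : eval (env a b t) (Var (arg_var i)) = tnth a i.
Proof. exact: tnth_lshift. Qed.

End Environment.

Definition defines f (psi : formula (arity f + 2)) : Prop :=
  forall d t, t <= d -> forall (a : (arity f).-tuple (M d)) b,
  componentwise t f a = b <-> holds (env a b t) psi.

Definition represents f (u : term (arity f + 2)) : Prop :=
  forall d t, t < d -> forall (a : (arity f).-tuple (M d)) b,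
  componentwise t f a = eval (env a b t) u.

Arguments defines f psi : clear implicits.
Arguments represents f u : clear implicits.

Definition top_level k : formula (k + 2) :=
  FEq (app Pow [tuple Var (level_var k)]) (app Len [tuple]).

Definition self_term f : term (arity f + 2) := App (fun i => Var (arg_var i)).

(* At the top level t = d the base 2 ^ 2 ^ t is not an element of M d. *)
Definition graph_formula f (u : term (arity f + 2)) : formula (arity f + 2) :=
  let y := Var (value_var (arity f)) in
  let top := top_level (arity f) in
  FOr (FAnd top (FEq (self_term f) y)) (FAnd (FNot top) (FEq u y)).

Lemma eval_self_term d t f (a : (arity f).-tuple (M d)) b :
  eval (env a b t) (self_term f) = interp f a.
Proof.
congr (interp f _); apply: eq_from_tnth => i.
by rewrite tnth_mktuple [LHS]eval_arg.
Qed.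

Lemma componentwise_top d f (a : (arity f).-tuple (M d)) :
  componentwise d f a = interp f a.
Proof.
have digit0 (x : M d) : digit d x 0 = x.
  by apply: val_inj; rewrite /= divn1 modn_small.
apply/componentwiseP => //; apply/forallP => -[i /=]; rewrite subnn.
case: i => // _; rewrite digit0; apply/eqP; congr (interp f _).
by apply: eq_from_tnth => j; rewrite tnth_mktuple digit0.
Qed.

Lemma holds_top_level d k t (a : k.-tuple (M d)) b :
  t <= d -> holds (env a b t) (top_level k) <-> t = d.
Proof.
move=> le_td; have powE := eval_pow_level a b le_td.
have lenE : eval (env a b t) (app Len [tuple]) = 2 ^ d :> nat.
  by rewrite eval_app interp_len.
split=> [/(congr1 val)|eq_td].
  by rewrite [LHS]powE [RHS]lenE => /eqP; rewrite eqn_exp2l // => /eqP.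
by apply: val_inj; rewrite [LHS]powE [RHS]lenE eq_td.
Qed.

Lemma defines_graph_formula f u :
  represents f u -> defines f (graph_formula u).
Proof.
move=> u_f d t le_td a b; have topP := holds_top_level a b le_td.
have -> : holds (env a b t) (graph_formula u) <->
    t = d /\ interp f a = b \/ t <> d /\ eval (env a b t) u = b.
  by rewrite -topP -(eval_self_term t a b) /= [tnth _ (value_var _)]eval_value.
have [eq_td|/eqP ne_td] := eqVneq t d.
  by rewrite {1}eq_td componentwise_top; tauto.
have lt_td : t < d by rewrite ltn_neqAle le_td andbT; apply/eqP.
by rewrite (u_f _ _ lt_td a b); tauto.
Qed.

Lemma componentwise_eq d t f (a : (arity f).-tuple (M d)) (b : M d) : t <= d ->
  (forall i, i < 2 ^ (d - t) ->
     interp f [tuple digit t (tnth a j) i | j < arity f]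
     = digitn (2 ^ 2 ^ t) b i :> nat) ->
  componentwise t f a = b.
Proof.
move=> le_td eq_digits; apply/componentwiseP => //; apply/forallP => i.
by apply/eqP/val_inj; rewrite [LHS]eq_digits // [RHS]digitE.
Qed.

Section Representations.

Local Notation z f := (Var (level_var (arity f))).
Local Notation x f := (Var (@arg_var (arity f) ord0)).
Local Notation y f := (Var (@arg_var (arity f) ord_max)).

Lemma digit_arg d t k (a : k.-tuple (M d)) b i j :
  digitn (2 ^ 2 ^ t) (eval (env a b t) (Var (arg_var j))) i
  = digit t (tnth a j) i.
Proof. by rewrite eval_arg digitE. Qed.

Lemma zero_represented : represents Zero (app Zero [tuple]).
Proof.
move=> d t lt_td a b; apply: (componentwise_eq (ltnW lt_td)) => i lt_im.
by rewrite eval_app !interp_zero /digitn div0n mod0n.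
Qed.

Lemma one_represented : represents One (repunit (z One)).
Proof.
move=> d t lt_td a b; apply: (componentwise_eq (ltnW lt_td)) => i lt_im.
by rewrite interp_one (digit_repunit lt_td) ?eval_level // ltnW.
Qed.

Lemma minus_one_represented : represents MinusOne (app MinusOne [tuple]).
Proof.
move=> d t lt_td a b; apply: (componentwise_eq (ltnW lt_td)) => i lt_im.
rewrite interp_minus_one eval_minus_one -(expn2_levels (ltnW lt_td)).
by rewrite digitn_expn_sub1 ?M_gt0.
Qed.

Lemma len_represented :
  represents Len (app Mul [tuple app Pow [tuple z Len]; repunit (z Len)]).
Proof.
move=> d t lt_td a b; have le_td := ltnW lt_td.
apply: (componentwise_eq le_td) => i lt_im.
have repunit_digit j : j < 2 ^ (d - t) ->
    digitn (2 ^ 2 ^ t) (eval (env a b t) (repunit (z Len))) j = 1.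
  by move=> lt_jm; rewrite (digit_repunit lt_td) ?eval_level.
rewrite interp_len (digit_mul_small le_td) // => [|j lt_jm];
  rewrite eval_pow_level // repunit_digit // muln1 //.
exact: ltn_expl.
Qed.

Lemma compl_represented : represents Compl (app Compl [tuple x Compl]).
Proof.
move=> d t lt_td a b; apply: (componentwise_eq (ltnW lt_td)) => i lt_im.
rewrite interp_compl tnth_mktuple (digit_compl _ (ltnW lt_td)) // digit_arg.
by rewrite bitcomplE.
Qed.

Lemma add_represented : represents Add (vector_sum (z Add) (x Add) (y Add)).
Proof.
move=> d t lt_td a b; have le_td := ltnW lt_td.
apply: (componentwise_eq le_td) => i lt_im; rewrite interp_add !tnth_mktuple.
by rewrite (digit_vector_sum lt_td) ?eval_level // !digit_arg.
Qed.

Lemma max_represented :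
  represents Max (blend (gt_mask (z Max) (x Max) (y Max)) (x Max) (y Max)).
Proof.
move=> d t lt_td a b; have le_td := ltnW lt_td.
apply: (componentwise_eq le_td) => i lt_im; rewrite interp_max !tnth_mktuple.
rewrite (digit_blend le_td _ _ (digit_gt_mask lt_td _ _ _)) ?eval_level //=.
by rewrite !digit_arg maxnC.
Qed.

Lemma min_represented :
  represents Min (blend (gt_mask (z Min) (x Min) (y Min)) (y Min) (x Min)).
Proof.
move=> d t lt_td a b; have le_td := ltnW lt_td.
apply: (componentwise_eq le_td) => i lt_im; rewrite interp_min !tnth_mktuple.
rewrite (digit_blend le_td _ _ (digit_gt_mask lt_td _ _ _)) ?eval_level //=.
by rewrite !digit_arg minnC.
Qed.

Lemma cap_represented : represents Cap (app Cap [tuple x Cap; y Cap]).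
Proof.
move=> d t lt_td a b; apply: (componentwise_eq (ltnW lt_td)) => i lt_im.
by rewrite interp_cap !tnth_mktuple (digit_cap _ (ltnW lt_td)) // !digit_arg.
Qed.

End Representations.

Lemma representable f : f <> Mul -> f <> Div -> f <> Pow ->
  exists u, represents f u.
Proof.
case: f => // _ _ _; eexists.
- exact: zero_represented.
- exact: one_represented.
- exact: minus_one_represented.
- exact: len_represented.
- exact: compl_represented.
- exact: add_represented.
- exact: max_represented.
- exact: min_represented.
- exact: cap_represented.
Qed.

Theorem theorem6 (f : symbol) (hMul : f <> Mul) (hDiv : f <> Div) (hPow : f <> Pow) :
  exists2 psi : formula (arity f + 2), existential psi &
    forall d t : nat, t <= d ->
    forall (a : (arity f).-tuple (M d)) (b : M d),
      componentwise t f a = b <-> holds [tuple of a ++ [:: b; inM d t]] psi.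
Proof.
have [u u_f] := representable hMul hDiv hPow.
by exists (graph_formula u); last exact: defines_graph_formula u_f.
Qed.
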